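(* Assume (A1) and (A3). Let $\alpha<1$, let $\Theta=(\theta_1,\dots,\theta_J)\in\mathsf T^J$ be fixed and let $\kappa\le 0$. Then for every $\boldsymbol\lambda\in\mathcal S_J$ we have $\Psi_\alpha(\mu_{\boldsymbol\lambda,\Theta})<\infty$, and for every $\eta>0$ the sequence $(\boldsymbol\lambda_n)_{n\ge1}$ defined by an arbitrary $\boldsymbol\lambda_1\in\mathcal S_J$ and $\boldsymbol\lambda_{n+1}=\mathcal I^{\mathrm{mixt}}_\alpha(\boldsymbol\lambda_n)$ is well-defined (all normalising sums lie in $(0,\infty)$). If in addition $\boldsymbol\lambda_1\in\mathcal S_J^+$, $\eta\in(0,1]$, and the measures $K(\theta_1,\cdot),\dots,K(\theta_J,\cdot)$ are linearly independent, then: (i) $(\Psi_\alpha(\mu_{\boldsymbol\lambda_n,\Theta}))_{n\ge1}$ is nonincreasing; (ii) $(\boldsymbol\lambda_n)_{n\ge1}$ converges to some $\boldsymbol\lambda^\star\in\mathcal S_J$ which is a fixed point of $\mathcal I^{\mathrm{mixt}}_\alpha$; (iii) $\Psi_\alpha(\mu_{\boldsymbol\lambda^\star,\Theta})=\inf_{\boldsymbol\lambda'\in\mathcal S_J}\Psi_\alpha(\mu_{\boldsymbol\lambda',\Theta})$.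
   Context: Let $(\mathsf Y,\mathcal Y,\nu)$ be a measure space with $\nu$ $\sigma$-finite, and $(\mathsf T,\mathcal T)$ a measurable space. Let $k:\mathsf T\times\mathsf Y\to[0,\infty)$ be measurable with $\int_{\mathsf Y}k(\theta,y)\nu(dy)=1$ for all $\theta$, and $K(\theta,A)=\int_A k(\theta,y)\nu(dy)$. Let $p$ be a measurable positive function on $\mathsf Y$. For a probability measure $\mu$ on $\mathsf T$ write $\mu k(y)=\int_{\mathsf T}\mu(d\theta)k(\theta,y)$. For $\alpha\in\mathbb R$ let $f_0(u)=u-1-\log u$, $f_1(u)=1-u+u\log u$, and $f_\alpha(u)=\frac{1}{\alpha(\alpha-1)}[u^\alpha-1-\alpha(u-1)]$ for $\alpha\notin\{0,1\}$ ($u>0$); so $f_\alpha'(u)=\frac{u^{\alpha-1}-1}{\alpha-1}$ for $\alpha\neq1$. Define $\Psi_\alpha(\mu)=\int_{\mathsf Y}f_\alpha\big(\mu k(y)/p(y)\big)p(y)\nu(dy)$ and $b_{\mu,\alpha}(\theta)=\int_{\mathsf Y}k(\theta,y)f_\alpha'\big(\mu k(y)/p(y)\big)\nu(dy)$. Assumption (A1): $k(\theta,y)>0$ and $p(y)>0$ for all $(\theta,y)$, and $\int_{\mathsf Y}p\,d\nu<\infty$. Mixture setting: $\mathcal S_J=\{\boldsymbol\lambda\in\mathbb R^J:\lambda_j\ge0,\sum_j\lambda_j=1\}$, $\mathcal S_J^+=\{\boldsymbol\lambda\in\mathcal S_J:\lambda_j>0\ \forall j\}$, and for $\Theta=(\theta_1,\dots,\theta_J)\in\mathsf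 T^J$, $\mu_{\boldsymbol\lambda,\Theta}=\sum_{j=1}^J\lambda_j\delta_{\theta_j}$. Given $\eta>0$ and $\kappa$ with $(\alpha-1)\kappa\ge0$, let $\Gamma_\alpha(v)=[(\alpha-1)v+1]^{\eta/(1-\alpha)}$ and $\mathcal I^{\mathrm{mixt}}_\alpha(\boldsymbol\lambda)=\Big(\frac{\lambda_j\Gamma_\alpha(b_{\mu_{\boldsymbol\lambda,\Theta},\alpha}(\theta_j)+\kappa)}{\sum_{\ell=1}^J\lambda_\ell\Gamma_\alpha(b_{\mu_{\boldsymbol\lambda,\Theta},\alpha}(\theta_\ell)+\kappa)}\Big)_{1\le j\le J}$ (the Power Descent update on the mixture weights). Assumption (A3): (i) for all $y$, $\theta\mapsto k(\theta,y)$ is continuous (with $\mathsf T$ a metric space with Borel $\sigma$-field); (ii) $\int_{\mathsf Y}\max_{1\le j\le J}k(\theta_j,y)\cdot\max_{1\le j'\le J}\big(k(\theta_{j'},y)/p(y)\big)^{\alpha-1}\nu(dy)<\infty$; if $\alpha=0$, additionally $\int_{\mathsf Y}\max_{1\le j\le J}|\log(k(\theta_j,y)/p(y))|\,p(y)\nu(dy)<\infty$. *)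

(* Defs.v *)
From HB Require Import structures.
From mathcomp Require Import all_boot all_order all_algebra.
From mathcomp Require Import all_classical all_reals all_analysis.
Set Implicit Arguments. Unset Strict Implicit. Unset Printing Implicit Defensive.
Import Order.TTheory GRing.Theory Num.Theory.
Import numFieldNormedType.Exports.
Local Open Scope classical_set_scope.
Local Open Scope ring_scope.

Section Defs.
Variable R : realType.

Definition falpha (a u : R) : R :=
  if a == 0 then u - 1 - ln u
  else if a == 1 then 1 - u + u * ln u
  else (u `^ a - 1 - a * (u - 1)) / (a * (a - 1)).

(* f_alpha' for alpha <> 1 (the only case used: alpha < 1) *)
Definition dfalpha (a u : R) : R := (u `^ (a - 1) - 1) / (a - 1).

Definition Gamma_alpha (a eta v : R) : R := ((a - 1) * v + 1) `^ (eta / (1 - a)).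

Definition simplex (J : nat) (lam : 'I_J -> R) : Prop :=
  (forall j, 0 <= lam j) /\ \sum_(j < J) lam j = 1.
Definition simplex_pos (J : nat) (lam : 'I_J -> R) : Prop :=
  (forall j, 0 < lam j) /\ \sum_(j < J) lam j = 1.

Definition borel_sets (T : topologicalType) : set (set T) := <<s open >>.
Definition prod_sigma (T : topologicalType) (d : measure_display)
  (Y : measurableType d) : set (set (T * Y)) :=
  <<s [set X | exists A C, borel_sets A /\ measurable C /\ X = A `*` C] >>.
Definition jointly_measurable (T : topologicalType) (d : measure_display)
  (Y : measurableType d) (k : T -> Y -> R) : Prop :=
  forall B : set R, measurable B ->
    @prod_sigma T d Y [set z : T * Y | B (k z.1 z.2)].

Variables (d : measure_display) (Y : measurableType d) (T : Type).

Definition mixk (k : T -> Y -> R) (J : nat) (Th : 'I_J -> T)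
  (lam : 'I_J -> R) (y : Y) : R := \sum_(j < J) lam j * k (Th j) y.

Variable nu : {measure set Y -> \bar R}.

Definition Psi (k : T -> Y -> R) (p : Y -> R) (a : R) (J : nat)
  (Th : 'I_J -> T) (lam : 'I_J -> R) : \bar R :=
  (\int[nu]_y (falpha a (mixk k Th lam y / p y) * p y)%:E)%E.

Definition b_integrand (k : T -> Y -> R) (p : Y -> R) (a : R) (J : nat)
  (Th : 'I_J -> T) (lam : 'I_J -> R) (th : T) (y : Y) : R :=
  k th y * dfalpha a (mixk k Th lam y / p y).

Definition bmu (k : T -> Y -> R) (p : Y -> R) (a : R) (J : nat)
  (Th : 'I_J -> T) (lam : 'I_J -> R) (th : T) : R :=
  Rintegral nu setT (b_integrand k p a Th lam th).

Definition norm_sum (k : T -> Y -> R) (p : Y -> R) (a eta kappa : R) (J : nat)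
  (Th : 'I_J -> T) (lam : 'I_J -> R) : R :=
  \sum_(l < J) lam l * Gamma_alpha a eta (bmu k p a Th lam (Th l) + kappa).

Definition Imixt (k : T -> Y -> R) (p : Y -> R) (a eta kappa : R) (J : nat)
  (Th : 'I_J -> T) (lam : 'I_J -> R) : 'I_J -> R :=
  fun j => lam j * Gamma_alpha a eta (bmu k p a Th lam (Th j) + kappa)
           / norm_sum k p a eta kappa Th lam.

Definition Kmeas (k : T -> Y -> R) (th : T) (A : set Y) : \bar R :=
  (\int[nu]_(y in A) (k th y)%:E)%E.

Definition lin_indep_measures (k : T -> Y -> R) (J : nat) (Th : 'I_J -> T) : Prop :=
  forall c : 'I_J -> R,
    (forall A : set Y, measurable A ->
       (\sum_(j < J) (c j)%:E * Kmeas k (Th j) A)%E = 0%E) ->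
    forall j, c j = 0.

End Defs.

(* Main.v *)
Require Import Defs.
From HB Require Import structures.
From mathcomp Require Import all_boot all_order all_algebra.
From mathcomp Require Import all_classical all_reals all_analysis.
From mathcomp Require Import measurable_realfun ring lra.
Import Order.TTheory GRing.Theory Num.Theory.
Import numFieldNormedType.Exports.
Local Open Scope classical_set_scope.
Local Open Scope ring_scope.
Set Implicit Arguments.
Unset Strict Implicit.

(** Let w = mu k / p and b = b_mu, the gradient of Psi. Since
    (a - 1) b_j + 1 = int k_j w^(a-1) =: x_j, the update multiplies lambda_j by
    g_j proportional to (x_j + (a - 1) kappa)^(eta/(1-a)). Jensen's inequality
    under the posterior weights bounds Psi after any reweighting lambda_j g_j by
    Psi + sum_j lambda_j x_j h(g_j), where h is f_alpha plus an affine function,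
    and Chebyshev's sum inequality makes the last sum nonpositive for the power
    weights, with equality only when g = 1 on the support: Psi is a strict
    Lyapunov function, so all limit points of the iterates are fixed points with
    the same value of Psi.

    At a fixed point b is constant on the support, so by strict convexity, given
    by linear independence, it is the only minimiser of Psi over the face of its
    support. A limit point close to another one has a larger support, hence
    coincides with it: limit points are isolated, and the update being
    continuous the iterates converge. If x_j exceeded the common level at the
    limit for some j, then the positive weights lambda_{n,j} would eventually
    increase and j would be in the support; thus the first-order optimality
    condition holds at the limit. *)

Section falpha_theory.
Context {R : realType}.
Implicit Types a s t u w : R.

Lemma lt_ln_subr1 u : 0 < u -> u != 1 -> ln u < u - 1.
Proof.
move=> u0 u1; have := @expR_gt1Dx R (ln u); rewrite ln_eq0// u1 => /(_ isT).
by rewrite lnK ?posrE// ltrBrDl.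
Qed.

Lemma falpha1 a : falpha a 1 = 0.
Proof.
rewrite /falpha powR1 ln1; case: ifP => _; first by ring.
by case: ifP => _; rewrite !subrr ?mulr0 ?addr0 ?subrr ?mul0r.
Qed.

Lemma falpha_dual a u : 0 < u -> falpha (1 - a) u = u * falpha a u^-1.
Proof.
move=> u0; have un0 := lt0r_neq0 u0.
have powRV : u^-1 `^ a = u `^ (- a).
  by rewrite -(powR_inv1 (ltW u0)) -powRrM mulN1r.
rewrite /falpha powRV lnV ?posrE//.
have [->|a0] := eqVneq a 0.
  by rewrite subr0 oner_eq0 eqxx; field.
rewrite subr_eq0 [1 == a]eq_sym.
have [_|a1] := eqVneq a 1; first by field.
have a01 : 1 - a != 1 by apply: contra_neq a0 => ?; lra.
rewrite (negbTE a01) powRD ?un0 ?implybT// powRr1 ?ltW//; field.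
by rewrite !subr_eq0 a0 un0 a1 a01 eq_sym.
Qed.

Lemma falpha_root a u : a != 0 -> 0 < u ->
  falpha a u = falpha a^-1 (u `^ a) / a ^+ 2.
Proof.
move=> a0 u0; rewrite /falpha invr_eq0 (negbTE a0) invr_eq1 -powRrM divff//.
rewrite powRr1 ?ltW//; have [->|a1] := eqVneq a 1.
  by rewrite powRr1 ?ltW// expr1n divr1.
by field; rewrite mulN1r !subr_eq0 a0 eq_sym a1.
Qed.

Lemma falpha_gt0 a u : 0 < u -> u != 1 -> 0 < falpha a u.
Proof.
have le0_gt0 (b v : R) : b <= 0 -> 0 < v -> v != 1 -> 0 < falpha b v.
  rewrite le_eqVlt => /predU1P[-> v0 v1|b0 v0 v1].
    by rewrite /falpha eqxx subr_gt0 lt_ln_subr1.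
  rewrite /falpha (lt_eqF b0) (lt_eqF (lt_trans b0 ltr01)).
  rewrite divr_gt0//; last by rewrite nmulr_rgt0// subr_lt0 (lt_trans b0 ltr01).
  rewrite subr_gt0 ltrBrDl /powR (gt_eqF v0).
  apply: le_lt_trans (expR_gt1Dx _); last by rewrite mulf_neq0 ?ln_eq0// lt_eqF.
  by rewrite lerD2l ler_nM2l// ltW// lt_ln_subr1.
have ge1_gt0 (b v : R) : 1 <= b -> 0 < v -> v != 1 -> 0 < falpha b v.
  move=> b1 v0 v1; rewrite -[b](subKr 1) falpha_dual// mulr_gt0//.
  by rewrite le0_gt0 ?subr_le0 ?invr_gt0 ?invr_eq1.
move=> u0 u1; have [/le0_gt0->//|a0] := leP a 0.
have [/ge1_gt0->//|a1] := leP 1 a.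
rewrite falpha_root ?gt_eqF// divr_gt0 ?exprn_gt0//.
rewrite ge1_gt0 ?invf_ge1 ?powR_gt0 1?ltW//.
by rewrite powR_eq1 (negbTE u1) gt_eqF// ltNge ltW.
Qed.

Lemma falpha_ge0 a u : 0 < u -> 0 <= falpha a u.
Proof.
by move=> u0; have [->|u1] := eqVneq u 1; rewrite ?falpha1// ltW// falpha_gt0.
Qed.

(* Up to a constant, u^a / (a (a - 1)), or - ln u when a = 0. *)
Definition halpha a u : R := falpha a u + (u - 1) / (a - 1).

Lemma powR_subr1M a u : 0 < u -> u `^ (a - 1) * u = u `^ a.
Proof.
move=> u0; rewrite -[X in _ * X]powRr1 ?ltW// -powRD ?subrK//.
by rewrite (gt_eqF u0) implybT.
Qed.

Lemma falphaM a t w : a != 1 -> 0 < t -> 0 < w ->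
  falpha a (t * w) = falpha a w + w `^ a * halpha a t - (t * w - w) / (a - 1).
Proof.
move=> a1 t0 w0; rewrite /halpha /falpha (negbTE a1).
have [->|a0] := eqVneq a 0; first by rewrite powRr0 lnM ?posrE//; field.
by rewrite powRM ?ltW//; field; rewrite a0 subr_eq0 a1.
Qed.

Lemma falpha_bregman a w u : a != 1 -> 0 < w -> 0 < u ->
  falpha a u = falpha a w + dfalpha a w * (u - w) + w `^ a * falpha a (u / w).
Proof.
move=> a1 w0 u0; rewrite -[in LHS](divfK (lt0r_neq0 w0) u).
rewrite [LHS]falphaM ?divr_gt0// /halpha /dfalpha -(powR_subr1M a w0); field.
by rewrite subr_eq0 a1 gt_eqF.
Qed.

Lemma halpha_tangent_gap a s t : a != 1 -> 0 < s -> 0 < t ->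
  halpha a t = halpha a s + s `^ (a - 1) / (a - 1) * (t - s)
             + s `^ a * falpha a (t / s).
Proof.
move=> a1 s0 t0; rewrite /halpha (falpha_bregman a1 s0 t0) /dfalpha; field.
by rewrite subr_eq0.
Qed.

Lemma halpha_tangent a s t : a != 1 -> 0 < s -> 0 < t ->
  halpha a s + s `^ (a - 1) / (a - 1) * (t - s) <= halpha a t.
Proof.
move=> a1 s0 t0; rewrite (halpha_tangent_gap a1 s0 t0) lerDl.
by rewrite mulr_ge0 ?powR_ge0// falpha_ge0// divr_gt0.
Qed.

End falpha_theory.

Section cluster_points.
Context {T U : topologicalType}.
Implicit Types (A B : set T) (f : T -> U) (z : T).

Lemma closed_cluster (F : set_system T) B z :
  closed B -> F B -> cluster F z -> B z.
Proof. by move=> cB FB; rewrite clusterE => /(_ _ FB); exact: cB. Qed.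

Lemma cluster_within_fmap (F : set_system T) {FF : Filter F} A f z :
  F A -> f @ within A (nbhs z) --> f z -> cluster F z ->
  cluster (f @ F) (f z).
Proof.
move=> FA fz clz B C FB /fz zC.
have [t [[Bt At] /(_ At) Ct]] := clz _ _ (filterI (FB : F (f @^-1` B)) FA) zC.
by exists (f t).
Qed.

Lemma compact_near_notin (I : Type) (G : set_system I) {FG : Filter G}
    (x : I -> T) A :
  compact A -> (forall y, A y -> ~ cluster (x @ G) y) ->
  \forall i \near G, ~ A (x i).
Proof.
move=> /compact_near_coveringP cA ncl.
have /cA : forall y, A y -> \forall y' \near y & i \near G, x i <> y'.
  move=> y /ncl/existsNP[B /existsNP[C /not_implyP[GB /not_implyP[yC BC0]]]].
  exists (C, x @^-1` B) => //= -[y' i] [/= Cy' Bi] xy'.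
  by apply: BC0; exists (x i); split => //; rewrite xy'.
by apply: filterS => i Ai Axi; exact: Ai Axi erefl.
Qed.

End cluster_points.

Section iterates_in_compact.
Context {R : realType} {T : uniformType}.
Variables (A : set T) (f : T -> T) (x : nat -> T).
Hypotheses (hausdorffT : hausdorff_space T) (compactA : compact A).
Hypotheses (continuous_f : {within A, continuous f}).
Hypotheses (xA : forall n, A (x n)) (xS : forall n, x n.+1 = f (x n)).

Let closedA : closed A. Proof. exact: compact_closed. Qed.

Let x_in_A : (x @ \oo) A. Proof. by exists 0%N => // n _; exact: xA. Qed.

Lemma cluster_iterates_in z : cluster (x @ \oo) z -> A z.
Proof. exact: closed_cluster. Qed.

Let cvg_at_cluster (U : topologicalType) (h : T -> U) z :
  {within A, continuous h} -> cluster (x @ \oo) z ->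
  h @ within A (nbhs z) --> h z.
Proof. by move=> /subspace_continuousP hA /cluster_iterates_in/hA. Qed.

Lemma cluster_iterates_image z :
  cluster (x @ \oo) z -> cluster (x @ \oo) (f z).
Proof.
move=> clz; suff xf : f @ (x @ \oo) --> x @ \oo.
  apply: (cvg_cluster xf); apply: (cluster_within_fmap x_in_A _ clz).
  exact: cvg_at_cluster.
move=> B [N _ NB]; exists N => // n /= Nn.
by rewrite -xS; apply: NB => /=; rewrite leqW.
Qed.

(* The points of V that f may move out of V, lying away from z and adherent to
   V, form a relatively compact set without limit points. *)
Lemma near_iterates_stay z V : cluster (x @ \oo) z -> f z = z -> nbhs z V ->
  (forall y, closure V y -> cluster (x @ \oo) y -> y = z) ->
  \forall n \near \oo, V (x n) -> V (x n.+1).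
Proof.
move=> clz fz zV isolated.
have fV : within A (nbhs z) (f @^-1` V).
  by apply: (cvg_at_cluster continuous_f clz); rewrite fz.
pose W := V `&` [set y | A y -> V (f y)].
have zW : nbhs z W by exact: filterI.
have compact_escape : compact (A `&` (closure V `&` ~` W°)).
  apply: compact_closedI => //; apply: closedI; first exact: closed_closure.
  exact/open_closedC/open_interior.
apply: filterS (compact_near_notin compact_escape _) => [n notin Vn|].
  suff [_ /(_ (xA n))] : W (x n) by rewrite xS.
  apply: contrapT => nW; apply: notin; split => //; split.
    exact: subset_closure.
  by move=> /interior_subset.
by move=> y [_ [Vy Wy]] cly; apply: Wy; rewrite (isolated y).
Qed.

Lemma iterates_cvg_isolated z : cluster (x @ \oo) z -> f z = z ->
  (\forall y \near z, cluster (x @ \oo) y -> y = z) -> x @ \oo --> z.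
Proof.
move=> clz fz isolated U zU.
have [V zV VU] := uniform_regular (filterI zU isolated).
have [N _ stay] : \forall n \near \oo, V (x n) -> V (x n.+1).
  by apply: (near_iterates_stay clz) => // y /VU[].
have [m Nm Vm] : exists2 m, (N <= m)%N & V (x m).
  have frequently_N : (x @ \oo) [set x m | m in [set m | (N <= m)%N]].
    by exists N => // m Nm; exists m.
  by have [_ [[m Nm <-] Vm]] := clz _ _ frequently_N zV; exists m.
exists m => // n /= /subnKC <-.
suff /subset_closure/VU[] : V (x (m + (n - m))%N) by [].
elim: (n - m)%N => [|i Vi]; first by rewrite addn0.
by rewrite addnS; apply: stay Vi; rewrite /= (leq_trans Nm)// leq_addr.
Qed.

Variable g : T -> R.
Hypothesis continuous_g : {within A, continuous g}.
Hypothesis g_nonincreasing : forall y, A y -> g (f y) <= g y.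

Lemma lyapunov_nonincreasing : nonincreasing_seq (g \o x).
Proof. by apply/nonincreasing_seqP => n /=; rewrite xS g_nonincreasing. Qed.

Lemma cluster_lyapunov_eq z z' :
  cluster (x @ \oo) z -> cluster (x @ \oo) z' -> g z = g z'.
Proof.
suff lyapunov_le y y' :
    cluster (x @ \oo) y -> cluster (x @ \oo) y' -> g y <= g y'.
  by move=> clz clz'; apply/eqP; rewrite eq_le !lyapunov_le.
move=> cly cly'.
have xle n : g y <= g (x n).
  apply: (@closed_cluster _ (g @ (x @ \oo)) [set r | r <= g (x n)]).
  - exact: closed_le.
  - exists n => // m /= nm; exact: lyapunov_nonincreasing.
  - apply: (cluster_within_fmap x_in_A _ cly); exact: cvg_at_cluster.
apply: (@closed_cluster _ (g @ (x @ \oo)) [set r | g y <= r]).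
- exact: closed_ge.
- by exists 0%N => // n _; exact: xle.
- apply: (cluster_within_fmap x_in_A _ cly'); exact: cvg_at_cluster.
Qed.

Lemma cluster_lyapunov_fixpoint z :
  (forall y, A y -> g y <= g (f y) -> f y = y) ->
  cluster (x @ \oo) z -> f z = z.
Proof.
move=> strict clz; apply: strict; first exact: cluster_iterates_in.
by rewrite (cluster_lyapunov_eq clz (cluster_iterates_image clz)).
Qed.

End iterates_in_compact.

Lemma sequential_within_continuous (R : realType) (T : pseudoMetricType R)
    (U : topologicalType) (A : set T) (f : T -> U) :
  (forall u z, (forall n, A (u n)) -> A z -> u @ \oo --> z ->
    f \o u @ \oo --> f z) ->
  {within A, continuous f}.
Proof.
move=> fA; apply/subspace_continuousP => z Az B fzB; apply: contrapT => nB.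
have /choice[u uP] (n : nat) : exists t,
    [/\ ball z n.+1%:R^-1 t, A t & ~ B (f t)].
  apply: contrapT => /forallNP sub_B; apply: nB.
  apply/nbhs_ballP; exists n.+1%:R^-1 => /= [|t zt At].
    by rewrite invr_gt0.
  by apply: contrapT => nBt; apply: (sub_B t).
have uz : u @ \oo --> z.
  apply/cvg_ballP => e e0; near=> n; have [zu _ _] := uP n.
  apply: (@le_ball _ _ _ n.+1%:R^-1) => //; apply: ltW.
  by near: n; exact: (near_infty_natSinv_lt (PosNum e0)).
have [|N _ NB] := fA u z _ Az uz B fzB; first by move=> n; case: (uP n).
by case: (uP N) => _ _; apply; exact: NB (leqnn N).
Unshelve. all: by end_near. Qed.

Section simplex_mean.
Context {R : realType} {J : nat}.
Implicit Types (l x y g : 'I_J -> R) (a m r : R).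

Definition mean l x : R := \sum_(j < J) l j * x j.

Lemma simplex_le1 l j : simplex l -> l j <= 1.
Proof. by move=> [l0 l1]; rewrite -l1 (bigD1 j)//= lerDl sumr_ge0. Qed.

Lemma simplex_exists_gt0 l : simplex l -> exists j, 0 < l j.
Proof.
move=> [l0 l1]; apply/not_existsP => nl.
suff : \sum_(j < J) l j = 0 by rewrite l1 => /eqP; rewrite oner_eq0.
by apply: big1 => j _; apply/eqP; rewrite eq_le l0 andbT leNgt; exact/negP/nl.
Qed.

Lemma simplex_coordP l j : simplex l -> l j = 0 \/ 0 < l j.
Proof. by move=> [/(_ j)]; rewrite le_eqVlt => /predU1P[<-|]; [left|right]. Qed.

Lemma eq_mean l x y : simplex l -> (forall j, 0 < l j -> x j = y j) ->
  mean l x = mean l y.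
Proof.
move=> sl xy; apply: eq_bigr => j _.
by have [->|/xy->//] := simplex_coordP j sl; rewrite !mul0r.
Qed.

Lemma mean_cst l m : simplex l -> mean l (fun=> m) = m.
Proof. by move=> sl; rewrite /mean -mulr_suml sl.2 mul1r. Qed.

Lemma meanBr l x y : mean l (fun j => x j - y j) = mean l x - mean l y.
Proof. by rewrite /mean -sumrB; apply: eq_bigr => j _; rewrite mulrBr. Qed.

Lemma meanBl l z x : mean (fun j => l j - z j) x = mean l x - mean z x.
Proof. by rewrite /mean -sumrB; apply: eq_bigr => j _; rewrite mulrBl. Qed.

Lemma meanZr l x m : mean l (fun j => m * x j) = m * mean l x.
Proof. by rewrite /mean mulr_sumr; apply: eq_bigr => j _; rewrite mulrCA. Qed.

Lemma mean_normalize l x :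
  mean l x != 0 -> mean l (fun j => x j / mean l x) = 1.
Proof.
move=> m0; rewrite /mean; under eq_bigr do rewrite mulrA.
by rewrite -mulr_suml divff.
Qed.

Lemma mean_ge0 l x : simplex l -> (forall j, 0 <= x j) -> 0 <= mean l x.
Proof. by move=> sl x0; apply: sumr_ge0 => j _; rewrite mulr_ge0 ?sl.1. Qed.

Lemma ler_mean l x y : simplex l -> (forall j, x j <= y j) ->
  mean l x <= mean l y.
Proof. by move=> sl xy; apply: ler_sum => j _; rewrite ler_wpM2l ?sl.1. Qed.

Lemma mean_gt0 l x : simplex l -> (forall j, 0 < l j -> 0 < x j) ->
  0 < mean l x.
Proof.
move=> sl x0; have [i li] := simplex_exists_gt0 sl.
rewrite /mean (bigD1 i)//= ltr_wpDr ?mulr_gt0 ?x0//.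
apply: sumr_ge0 => j _; have [->|lj] := simplex_coordP j sl.
  by rewrite mul0r.
by rewrite mulr_ge0 ?ltW ?x0.
Qed.

Lemma mean_eq0 l x : simplex l -> (forall j, 0 <= x j) -> mean l x = 0 ->
  forall j, 0 < l j -> x j = 0.
Proof.
move=> sl x0 lx0 j lj.
have lx_ge0 i : true -> 0 <= l i * x i by rewrite mulr_ge0 ?sl.1.
have /(_ j isT)/eqP := psumr_eq0P lx_ge0 lx0.
by rewrite mulf_eq0 gt_eqF//= => /eqP.
Qed.

Lemma exists_le_mean l x : simplex l -> exists2 j, 0 < l j & x j <= mean l x.
Proof.
move=> sl; apply: contrapT => /forall2NP xm.
have : 0 < mean l (fun j => x j - mean l x).
  apply: mean_gt0 => // j lj; rewrite subr_gt0 ltNge; apply/negP.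
  by case: (xm j).
by rewrite meanBr mean_cst// subrr ltxx.
Qed.

Lemma exists_ge_mean l x : simplex l -> exists2 j, 0 < l j & mean l x <= x j.
Proof.
move=> sl; have [j lj] := exists_le_mean (fun j => -1 * x j) sl.
by rewrite meanZr !mulN1r lerN2 => xj; exists j.
Qed.

(* Chebyshev's sum inequality, m being the value of x where y is average. *)
Lemma mean_chebyshev l x y m : simplex l ->
  (forall j, 0 <= (x j - m) * (y j - mean l y)) ->
  0 <= mean l (fun j => x j * (y j - mean l y)).
Proof.
move=> sl /(mean_ge0 sl); set d := fun j => y j - mean l y.
have d0 : mean l d = 0 by rewrite meanBr mean_cst// subrr.
under [X in _ <= X -> _]eq_bigr do rewrite mulrBl mulrBr.
rewrite sumrB -/(mean l (fun j => x j * d j)) -/(mean l (fun j => m * d j)).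
by rewrite meanZr d0 mulr0 subr0.
Qed.

Lemma norm_ln_mean_le l x : simplex l -> (forall j, 0 < x j) ->
  `|ln (mean l x)| <= \big[Num.max/0]_(j < J) `|ln (x j)|.
Proof.
move=> sl x0; set M := \big[_/_]_(_ < _) _.
have lnM j : `|ln (x j)| <= M by exact: (le_bigmax 0 (fun i => `|ln (x i)|)).
have m0 : 0 < mean l x by exact: mean_gt0.
have [i _ xi] := exists_le_mean x sl; have [j _ xj] := exists_ge_mean x sl.
rewrite ler_norml; apply/andP; split.
  rewrite lerNl; apply: le_trans (lnM i); rewrite -normrN.
  by apply: le_trans (ler_norm _); rewrite lerN2 ler_ln ?posrE.
by apply: le_trans (lnM j); apply: le_trans (ler_norm _); rewrite ler_ln ?posrE.
Qed.

Lemma powR_mean_le l x r : simplex l -> (forall j, 0 < x j) -> r <= 0 ->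
  mean l x `^ r <= \big[Num.max/0]_(j < J) x j `^ r.
Proof.
move=> sl x0 r0; have [i _ xi] := exists_le_mean x sl.
apply: le_trans (le_bigmax 0 (fun j => x j `^ r) i).
have m0 : 0 < mean l x by exact: mean_gt0.
rewrite -[r]opprK !(powRN _ (- r)) lef_pV2 ?posrE ?powR_gt0//.
by rewrite ge0_ler_powR ?oppr_ge0// nnegrE ltW.
Qed.

Lemma halpha_jensen a l g : a != 1 -> simplex l -> (forall j, 0 < g j) ->
  halpha a (mean l g) <= mean l (halpha a \o g).
Proof.
move=> a1 sl g0; have m0 : 0 < mean l g by exact: mean_gt0.
set m := mean l g in m0 *; pose slope := m `^ (a - 1) / (a - 1).
have tangentE : mean l (fun j => halpha a m - slope * (m - g j)) = halpha a m.
  by rewrite meanBr meanZr meanBr !mean_cst// subrr mulr0 subr0.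
rewrite -[leLHS]tangentE; apply: ler_mean => // j /=.
by rewrite -mulrN opprB halpha_tangent.
Qed.

End simplex_mean.

Section weights_topology.
Context {R : realType} {J : nat}.
Import ArrowAsProduct.
Implicit Types (z : 'I_J -> R).

Lemma cvg_coordP (T : Type) (F : set_system T) {FF : Filter F}
    (u : T -> 'I_J -> R) z :
  u @ F --> z <-> forall j, u ^~ j @ F --> z j.
Proof.
split=> [uz j|uz].
  exact: cvg_comp uz (@proj_continuous _ (fun=> R) j z).
apply/cvg_sup => j; apply/cvg_image.
  by rewrite eqEsubset; split => // r _; exists (fun=> r).
move=> B /uz uB; exists [set x | B (x j)] => //.
by rewrite eqEsubset; split => [_ [x Bx <-]//|r Br]; exists (fun=> r).
Qed.

Lemma mean_cvg (T : Type) (F : set_system T) {FF : Filter F}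
    (u x : T -> 'I_J -> R) z y :
  u @ F --> z -> (forall j, x ^~ j @ F --> y j) ->
  (fun t => mean (u t) (x t)) @ F --> mean z y.
Proof.
move=> /cvg_coordP uz xy; apply: cvg_big => [|j _]; first exact: add_continuous.
by apply: cvgM; [exact: uz|exact: xy].
Qed.

Lemma hausdorff_weights : hausdorff_space ('I_J -> R).
Proof. by apply: hausdorff_product => j; exact: Rhausdorff. Qed.

Lemma compact_simplex : compact (@simplex R J).
Proof.
pose cube := [set l : 'I_J -> R | forall j, `[0, 1]%classic (l j)].
have cube_compact : compact cube.
  apply: (@tychonoff _ (fun=> R) (fun=> `[0, 1]%classic)) => j.
  exact: segment_compact.
have mean1_continuous : continuous (fun l : 'I_J -> R => mean l (fun=> 1)).
  move=> l; apply: (@mean_cvg _ (nbhs l) _ id (cst (cst 1)) l (cst 1)) => [|j].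
    exact: cvg_id.
  exact: cvg_cst.
have mean1 (l : 'I_J -> R) : mean l (fun=> 1) = \sum_(j < J) l j.
  by apply: eq_bigr => j _; rewrite mulr1.
rewrite (_ : @simplex R J =
    cube `&` (fun l : 'I_J -> R => mean l (fun=> 1)) @^-1` [set 1]).
  apply: compact_closedI => //; apply: preimage_closed => [l _|].
    exact: mean1_continuous.
  exact: closed_eq.
apply/seteqP; split=> l.
  move=> sl; split=> [j|]; last by rewrite /= mean1 sl.2.
  by rewrite /= in_itv/= sl.1 simplex_le1.
move=> [cl /= l1]; split=> [j|]; last by rewrite -mean1.
by have := cl j; rewrite /= in_itv/= => /andP[].
Qed.

Lemma near_support_sub z : \forall z' \near z, forall j, 0 < z j -> 0 < z' j.
Proof.
apply: (@filter_forall _ _ (fun j => [set z' | 0 < z j -> 0 < z' j]) _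
  (nbhs_filter z)) => j.
have [zj|_] := ltP 0 (z j); last exact: nearW.
have /cvg_coordP/(_ j) zzj : id @ nbhs z --> z by exact: cvg_id.
by apply: filterS (cvgr_gt _ zzj _ zj) => z' /= z'j _.
Qed.

End weights_topology.

Section reweighting.
Context {R : realType} {J : nat}.
Implicit Types (l x g z : 'I_J -> R).

Definition reweight l x (j : 'I_J) : R := l j * x j / mean l x.

Lemma reweightE l x : reweight l x = fun j => l j * (x j / mean l x).
Proof. by apply/funext => j; rewrite /reweight mulrA. Qed.

Lemma mean_reweight l x g :
  mean (reweight l x) g = mean l (fun j => x j * g j) / mean l x.
Proof.
rewrite /mean [RHS]mulr_suml; apply: eq_bigr => j _.
by rewrite /reweight mulrAC mulrA.
Qed.

Lemma reweight_simplex l x : simplex l -> (forall j, 0 < x j) ->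
  simplex (reweight l x).
Proof.
move=> sl x0; have m0 : 0 < mean l x by exact: mean_gt0.
rewrite reweightE; split=> [j|]; last by apply: mean_normalize; rewrite gt_eqF.
by rewrite mulr_ge0 ?sl.1// divr_ge0 ?ltW.
Qed.

Lemma reweight_gt0 l x j : simplex l -> (forall i, 0 < x i) -> 0 < l j ->
  0 < reweight l x j.
Proof. by move=> sl x0 lj; rewrite divr_gt0 ?mulr_gt0// mean_gt0. Qed.

Lemma reweight_fixpoint l x j : simplex l -> (forall i, 0 < x i) ->
  reweight l x = l -> 0 < l j -> x j = mean l x.
Proof.
move=> sl x0 /(congr1 (@^~ j)) /= + lj.
rewrite /reweight -mulrA -[RHS]mulr1 => /(mulfI (lt0r_neq0 lj)).
by move=> /divr1_eq.
Qed.

Import ArrowAsProduct.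

Lemma reweight_cvg (T : Type) (F : set_system T) {FF : Filter F}
    (u v : T -> 'I_J -> R) z x :
  mean z x != 0 -> u @ F --> z -> (forall j, v ^~ j @ F --> x j) ->
  (fun t => reweight (u t) (v t)) @ F --> reweight z x.
Proof.
move=> m0 uz vx; apply/cvg_coordP => j; move/cvg_coordP : (uz) => uzj.
apply: cvgM; first by apply: cvgM; [exact: uzj|exact: vx].
by apply: cvgV => //; exact: mean_cvg.
Qed.

Lemma reweight_limit_fixpoint (u v : nat -> 'I_J -> R) z x :
  mean z x != 0 -> (forall n, u n.+1 = reweight (u n) (v n)) ->
  u @ \oo --> z -> (forall j, v ^~ j @ \oo --> x j) -> reweight z x = z.
Proof.
move=> m0 uS uz vx; apply/funext => j.
have /cvg_coordP/(_ j) : (fun n => reweight (u n) (v n)) @ \oo --> reweight z x.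
  exact: reweight_cvg.
under eq_cvg do rewrite -uS.
move/cvg_coordP : uz => /(_ j); rewrite -cvg_shiftS => uzj uSzj.
exact: cvg_unique uSzj uzj.
Qed.

(* If x j exceeded the mean, the weight of j would eventually increase, so that
   z would charge j; but x is equal to its mean on the support of z. *)
Lemma reweight_limit_le (u v : nat -> 'I_J -> R) z x j :
  (forall n, simplex (u n)) -> (forall n i, 0 < u n i) ->
  (forall n i, 0 < v n i) -> (forall n, u n.+1 = reweight (u n) (v n)) ->
  simplex z -> (forall i, 0 < x i) ->
  u @ \oo --> z -> (forall i, v ^~ i @ \oo --> x i) -> x j <= mean z x.
Proof.
move=> su u0 v0 uS sz x0 uz vx; have m0 : 0 < mean z x by exact: mean_gt0.
rewrite leNgt -subr_gt0; apply/negP => xj.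
have gap_cvg : (fun n => v n j - mean (u n) (v n)) @ \oo --> x j - mean z x.
  by apply: cvgB; [exact: vx|exact: mean_cvg].
have [N _ NP] := cvgr_gt _ gap_cvg _ xj.
have uN n : (N <= n)%N -> u N j <= u n j.
  move=> /subnKC <-; elim: (n - N)%N => [|i ih]; first by rewrite addn0.
  rewrite addnS uS (le_trans ih)// /reweight -mulrA ler_peMr ?ltW//.
  rewrite ltr_pdivlMr ?mul1r; last exact: mean_gt0.
  by rewrite -subr_gt0; apply: NP; rewrite /= leq_addr.
have zj : 0 < z j.
  apply: lt_le_trans (u0 N j) _; move/cvg_coordP : uz => /(_ j) uzj.
  by apply: (cvgr_to_ge uzj); exists N.
have fz : reweight z x = z.
  by apply: reweight_limit_fixpoint uS uz vx; rewrite gt_eqF.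
by move: xj; rewrite (reweight_fixpoint sz x0 fz zj) subrr ltxx.
Qed.

End reweighting.

Section Gamma_alpha_theory.
Context {R : realType}.
Implicit Types a eta u v : R.

Lemma Gamma_alpha_gt0 a eta v : 0 < (a - 1) * v + 1 -> 0 < Gamma_alpha a eta v.
Proof. exact: powR_gt0. Qed.

Lemma Gamma_alpha_le a eta u v : a < 1 -> 0 < eta ->
  0 < (a - 1) * u + 1 -> 0 < (a - 1) * v + 1 ->
  (Gamma_alpha a eta u <= Gamma_alpha a eta v) = (v <= u).
Proof.
move=> a1 eta0 u0 v0.
have phi0 : 0 < eta / (1 - a) by rewrite divr_gt0 ?subr_gt0.
rewrite /Gamma_alpha (le_mono_in (gt0_ltr_powR phi0)); last 2 first.
- by rewrite nnegrE ltW.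
- by rewrite nnegrE ltW.
by rewrite lerD2r ler_nM2l ?subr_lt0.
Qed.

Lemma Gamma_alpha_inj a eta u v : a < 1 -> 0 < eta ->
  0 < (a - 1) * u + 1 -> 0 < (a - 1) * v + 1 ->
  Gamma_alpha a eta u = Gamma_alpha a eta v -> u = v.
Proof.
move=> a1 eta0 u0 v0 uv; apply/eqP; rewrite eq_le.
rewrite -(Gamma_alpha_le a1 eta0 v0 u0) -(Gamma_alpha_le a1 eta0 u0 v0).
by rewrite uv lexx.
Qed.

End Gamma_alpha_theory.

Section powR_theory.
Context {R : realType}.
Implicit Types c r s eta x : R.

Lemma powR_cvg (T : Type) (F : set_system T) {FF : Filter F}
    (f : T -> R) x r :
  0 < x -> f @ F --> x -> (fun t => f t `^ r) @ F --> x `^ r.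
Proof.
move=> x0 fx; suff px : {for x, continuous (@powR R ^~ r)}.
  exact: (cvg_comp _ _ fx px).
apply: differentiable_continuous; apply/derivable1_diffP.
by apply: derivable_powR; rewrite in_itv/= x0.
Qed.

Lemma powR_shift_homo s c eta : 0 <= s -> 0 <= c -> 0 <= eta <= 1 ->
  {in Num.pos &, {homo (fun t => (t * s - c) * t `^ (- eta)) : t u / t <= u}}.
Proof.
move=> s0 c0 /andP[eta0 eta1] t u; rewrite !posrE => t0 u0 tu.
have shiftE (r : R) : 0 < r -> (r * s - c) * r `^ (- eta) =
    s * r `^ (1 - eta) - c * r `^ (- eta).
  by move=> r0; rewrite powRB ?(gt_eqF r0) ?implybT// powRr1 ?ltW// powRN; ring.
rewrite !shiftE// lerB ?ler_wpM2l//.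
  by rewrite ge0_ler_powR ?subr_ge0// nnegrE ltW.
rewrite !powRN lef_pV2 ?posrE ?powR_gt0//.
by rewrite ge0_ler_powR// nnegrE ltW.
Qed.

Lemma homo_comonotone (P : {pred R}) (f g : R -> R) :
  {in P &, {homo f : t u / t <= u}} -> {in P &, {homo g : t u / t <= u}} ->
  {in P &, forall t u, 0 <= (f t - f u) * (g t - g u)}.
Proof.
move=> hf hg t u Pt Pu; have [tu|/ltW ut] := leP t u.
  by rewrite mulr_le0// subr_le0 ?hf ?hg.
by rewrite mulr_ge0// subr_ge0 ?hf ?hg.
Qed.

End powR_theory.

Section power_gain.
Context {R : realType} {J : nat}.
Variables (a eta kappa : R) (l b : 'I_J -> R).
Hypotheses (a_lt1 : a < 1) (eta_gt0 : 0 < eta) (eta_le1 : eta <= 1).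
Hypotheses (kappa_le0 : kappa <= 0) (sl : simplex l).
Hypothesis b_dom : forall j, 0 < (a - 1) * b j + 1.

Let gain j := Gamma_alpha a eta (b j + kappa).
Let g j := gain j / mean l gain.
Let x j := (a - 1) * b j + 1.
Let c := (a - 1) * kappa.
Let phi := eta / (1 - a).

Let phi_gt0 : 0 < phi. Proof. by rewrite divr_gt0// subr_gt0. Qed.
Let c_ge0 : 0 <= c. Proof. by rewrite mulr_le0// subr_le0 ltW. Qed.
Let x_gt0 j : 0 < x j. Proof. exact: b_dom. Qed.
Let xc_gt0 j : 0 < x j + c. Proof. by rewrite ltr_wpDr. Qed.
Let gainE j : gain j = (x j + c) `^ phi.
Proof. by rewrite /gain /Gamma_alpha mulrDr addrAC. Qed.
Let gain_gt0 j : 0 < gain j. Proof. by rewrite gainE powR_gt0. Qed.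
Let mean_gain_gt0 : 0 < mean l gain. Proof. exact: mean_gt0. Qed.
Let g_gt0 j : 0 < g j. Proof. by rewrite divr_gt0. Qed.

Let mean_g : mean l g = 1. Proof. by rewrite mean_normalize// gt_eqF. Qed.

(* Writing g j = t j ^ phi and x j = t j * s - c with s fixed, both g j and
   x j * g j ^ (a - 1) = (t j * s - c) * t j ^ - eta are nondecreasing in
   t j. *)
Lemma power_gain_chebyshev :
  0 <= mean l (fun j => x j * g j `^ (a - 1) * (g j - 1)).
Proof.
pose s := mean l gain `^ phi^-1; pose t j := (x j + c) / s.
have s_gt0 : 0 < s by rewrite powR_gt0.
have t_gt0 j : 0 < t j by rewrite divr_gt0.
have sphi : s `^ phi = mean l gain.
  by rewrite -powRrM mulVf ?gt_eqF// powRr1// ltW.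
have gE j : g j = t j `^ phi.
  rewrite /g gainE -[x j + c](divfK (lt0r_neq0 s_gt0)) powRM ?(ltW (t_gt0 j))//.
    by rewrite sphi mulfK// gt_eqF.
  exact: ltW.
have xgE j : x j * g j `^ (a - 1) = (t j * s - c) * t j `^ (- eta).
  rewrite gE -powRrM /t divfK ?gt_eqF// addrK; congr (_ * _ `^ _).
  by rewrite /phi; field; rewrite subr_eq0 gt_eqF.
have eta01 : 0 <= eta <= 1 by rewrite ltW.
have shift_homo := powR_shift_homo (ltW s_gt0) c_ge0 eta01.
have power_homo : {in Num.pos &, {homo @powR R ^~ phi : r u / r <= u}}.
  by move=> r u r0 u0; apply: ge0_ler_powR; rewrite ?nnegrE ltW.
rewrite -mean_g; apply: (@mean_chebyshev _ _ _ _ _ (s - c)) => // j.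
rewrite mean_g xgE gE.
have := homo_comonotone shift_homo power_homo (t_gt0 j) (ltr01 : 1 \in Num.pos).
by rewrite !powR1 mul1r mulr1; apply; rewrite ltW.
Qed.

Let gap j := g j `^ a * falpha a (g j)^-1.

Let gap_ge0 j : 0 <= x j * gap j.
Proof.
rewrite mulr_ge0 ?(ltW (x_gt0 j))// mulr_ge0 ?powR_ge0//.
by rewrite falpha_ge0 ?invr_gt0.
Qed.

Let mean_halphaE : mean l (fun j => x j * halpha a (g j)) =
  (a - 1)^-1 * mean l (fun j => x j * g j `^ (a - 1) * (g j - 1)) -
  mean l (fun j => x j * gap j).
Proof.
have a_neq1 : a != 1 by rewrite lt_eqF.
rewrite -meanZr -meanBr; apply: eq_bigr => j _; congr (_ * _).
have := halpha_tangent_gap a_neq1 (g_gt0 j) ltr01.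
rewrite {1}/halpha falpha1 subrr mul0r addr0 div1r -/(gap j) => /esym/eqP.
rewrite -addrA addr_eq0 => /eqP ->; field.
by rewrite subr_eq0.
Qed.

Let mean_halpha_le :
  mean l (fun j => x j * halpha a (g j)) <= - mean l (fun j => x j * gap j).
Proof.
rewrite mean_halphaE gerDr mulr_le0_ge0 ?power_gain_chebyshev//.
by rewrite invr_le0 subr_le0 ltW.
Qed.

Lemma power_gain_halpha_le0 : mean l (fun j => x j * halpha a (g j)) <= 0.
Proof. by apply: le_trans mean_halpha_le _; rewrite oppr_le0 mean_ge0. Qed.

Lemma power_gain_halpha_eq0 : 0 <= mean l (fun j => x j * halpha a (g j)) ->
  forall j, 0 < l j -> g j = 1.
Proof.
move=> /le_trans/(_ mean_halpha_le); rewrite oppr_ge0 => mean_gap_le0 j lj.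
have /(mean_eq0 sl gap_ge0)/(_ j lj)/eqP : mean l (fun j => x j * gap j) = 0.
  by apply/eqP; rewrite eq_le mean_gap_le0 mean_ge0.
apply: contraTeq => gj1; rewrite gt_eqF// mulr_gt0//.
by rewrite mulr_gt0 ?powR_gt0// falpha_gt0 ?invr_gt0// invr_eq1.
Qed.

End power_gain.

Section simplex_subgradient.
Context {R : realType} {J : nat}.
Import ArrowAsProduct.
Variables (Phi : ('I_J -> R) -> R) (grad : ('I_J -> R) -> 'I_J -> R).
Hypothesis grad_continuous :
  forall j, {within @simplex R J, continuous (grad ^~ j)}.

Definition strict_subgradient := forall l z, simplex l -> simplex z ->
  l != z -> Phi z + (mean l (grad z) - mean z (grad z)) < Phi l.

Hypothesis Phi_strict : strict_subgradient.

Lemma strict_subgradient_le l z : simplex l -> simplex z ->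
  Phi z + (mean l (grad z) - mean z (grad z)) <= Phi l.
Proof.
move=> sl sz; have [->|lz] := eqVneq l z; first by rewrite subrr addr0.
exact/ltW/Phi_strict.
Qed.

Lemma strict_subgradient_continuous : {within @simplex R J, continuous Phi}.
Proof.
apply/subspace_continuousP => z sz.
have grad_cvg j : grad ^~ j @ within (@simplex R J) (nbhs z) --> grad z j.
  by have /subspace_continuousP := @grad_continuous j; apply.
have idz : id @ within (@simplex R J) (nbhs z) --> z by exact: cvg_within.
apply: (@squeeze_cvgr _ _ _ _
    (fun l => Phi z + (mean l (grad z) - mean z (grad z)))
    (fun l => Phi z - (mean z (grad l) - mean l (grad l)))).
- apply: filterS (withinT _ (nbhs_filter z)) => l sl.
  rewrite strict_subgradient_le//=.
  by rewrite lerBrDr strict_subgradient_le.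
- rewrite -[X in _ --> X]addr0 -(subrr (mean z (grad z))).
  apply: cvgD; first exact: cvg_cst.
  apply: cvgB; last exact: cvg_cst.
  by apply: mean_cvg => // j; exact: cvg_cst.
- rewrite -[X in _ --> X]subr0 -(subrr (mean z (grad z))).
  apply: cvgB; first exact: cvg_cst.
  apply: cvgB; last exact: mean_cvg.
  by apply: mean_cvg => //; exact: cvg_cst.
Qed.

End simplex_subgradient.

Section power_descent.
Context {R : realType} {J : nat}.
Import ArrowAsProduct.
Variables (a eta kappa : R).
Variables (Phi : ('I_J -> R) -> R) (grad : ('I_J -> R) -> 'I_J -> R).
Hypotheses (a_lt1 : a < 1) (eta_gt0 : 0 < eta) (kappa_le0 : kappa <= 0).
Hypothesis grad_dom : forall l j, simplex l -> 0 < (a - 1) * grad l j + 1.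
Implicit Types (l z : 'I_J -> R) (j : 'I_J).

Definition power_gain l j : R := Gamma_alpha a eta (grad l j + kappa).

Definition power_update l : 'I_J -> R := reweight l (power_gain l).

Lemma power_gain_dom l j : simplex l -> 0 < (a - 1) * (grad l j + kappa) + 1.
Proof.
move=> sl; rewrite mulrDr addrAC ltr_wpDr ?grad_dom//.
by rewrite mulr_le0// subr_le0 ltW.
Qed.

Lemma power_gain_gt0 l j : simplex l -> 0 < power_gain l j.
Proof. by move=> sl; rewrite Gamma_alpha_gt0// power_gain_dom. Qed.

Lemma mean_power_gain_gt0 l : simplex l -> 0 < mean l (power_gain l).
Proof. by move=> sl; apply: mean_gt0 => // j _; exact: power_gain_gt0. Qed.

Lemma power_update_simplex l : simplex l -> simplex (power_update l).
Proof.
by move=> sl; apply: reweight_simplex => // j; exact: power_gain_gt0.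
Qed.

Lemma power_update_gt0 l j : simplex l -> 0 < l j -> 0 < power_update l j.
Proof. by move=> sl; apply: reweight_gt0 => // i; exact: power_gain_gt0. Qed.

Lemma fixpoint_gradient_eq l i j : simplex l -> power_update l = l ->
  0 < l i -> 0 < l j -> grad l i = grad l j.
Proof.
move=> sl fl li lj; apply: (addIr kappa).
apply: (Gamma_alpha_inj a_lt1 eta_gt0); [exact: power_gain_dom..|].
have gain_mean k : 0 < l k -> power_gain l k = mean l (power_gain l).
  by apply: reweight_fixpoint => // k'; exact: power_gain_gt0.
by rewrite -![Gamma_alpha _ _ _]/(power_gain _ _) !gain_mean.
Qed.

Lemma fixpoint_mean_gradient z l i : simplex z -> power_update z = z ->
  0 < z i -> simplex l -> (forall j, 0 < l j -> 0 < z j) ->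
  mean l (grad z) = grad z i.
Proof.
move=> sz fz zi sl lz; rewrite -[RHS](mean_cst (grad z i) sl).
by apply: eq_mean => // j /lz zj; exact: fixpoint_gradient_eq.
Qed.

Hypothesis grad_continuous :
  forall j, {within @simplex R J, continuous (grad ^~ j)}.

Lemma power_gain_cvg (T : Type) (F : set_system T) {FF : Filter F}
    (u : T -> 'I_J -> R) z j :
  simplex z -> (\forall t \near F, simplex (u t)) -> u @ F --> z ->
  (fun t => power_gain (u t) j) @ F --> power_gain z j.
Proof.
move=> sz su uz; apply: powR_cvg; first exact: power_gain_dom.
apply: cvgD; last exact: cvg_cst.
apply: cvgM; first exact: cvg_cst.
apply: cvgD; last exact: cvg_cst.
have /subspace_continuousP/(_ z sz) Dz := @grad_continuous j.
apply: (cvg_comp u (grad ^~ j) _ Dz) => B zB /=.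
by apply: filterS2 su (uz _ zB) => t sut; apply.
Qed.

Lemma power_update_continuous : {within @simplex R J, continuous power_update}.
Proof.
apply/subspace_continuousP => z sz.
have near_simplex : \forall l \near within (@simplex R J) (nbhs z), simplex l.
  exact: withinT.
apply: reweight_cvg; first by rewrite gt_eqF// mean_power_gain_gt0.
  exact: cvg_within.
by move=> j; apply: power_gain_cvg => //; exact: cvg_within.
Qed.

Hypothesis Phi_strict : strict_subgradient Phi grad.

Lemma fixpoint_unique_on_support z z' : simplex z -> simplex z' ->
  power_update z' = z' -> (forall j, 0 < z j -> 0 < z' j) -> Phi z = Phi z' ->
  z = z'.
Proof.
move=> sz sz' fz' zz' Phizz'; apply/eqP/negbNE/negP => neq.
have := Phi_strict sz sz' neq; have [i zi] := simplex_exists_gt0 sz'.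
rewrite (fixpoint_mean_gradient sz' fz' zi sz zz').
rewrite (fixpoint_mean_gradient sz' fz' zi sz')//.
by rewrite subrr addr0 Phizz' ltxx.
Qed.

Lemma gain_le_mean_minimizer z : simplex z -> power_update z = z ->
  (forall j, power_gain z j <= mean z (power_gain z)) ->
  forall l, simplex l -> Phi z <= Phi l.
Proof.
move=> sz fz gain_le l sl; have [i zi] := simplex_exists_gt0 sz.
apply: le_trans (strict_subgradient_le Phi_strict sl sz).
rewrite lerDl subr_ge0 (fixpoint_mean_gradient sz fz zi sz)//.
rewrite -[leLHS](mean_cst (grad z i) sl); apply: ler_mean => // j.
rewrite -(lerD2r kappa) -(Gamma_alpha_le a_lt1 eta_gt0);
  [|exact: power_gain_dom..].
apply: le_trans (gain_le j) _; rewrite -[leRHS]/(power_gain z i).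
by rewrite -(reweight_fixpoint sz _ fz zi)// => k; exact: power_gain_gt0.
Qed.

Hypothesis eta_le1 : eta <= 1.
Hypothesis Phi_scale : forall l (g : 'I_J -> R), simplex l ->
  (forall j, 0 < g j) -> mean l g = 1 ->
  Phi (fun j => l j * g j) <=
  Phi l + mean l (fun j => ((a - 1) * grad l j + 1) * halpha a (g j)).

Let g l j := power_gain l j / mean l (power_gain l).

Let power_updateE l : power_update l = fun j => l j * g l j.
Proof. exact: reweightE. Qed.

Let Phi_update_le l : simplex l -> Phi (power_update l) <=
  Phi l + mean l (fun j => ((a - 1) * grad l j + 1) * halpha a (g l j)).
Proof.
move=> sl; rewrite power_updateE; apply: Phi_scale => // [j|].
  by rewrite divr_gt0 ?power_gain_gt0 ?mean_power_gain_gt0.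
by rewrite mean_normalize// gt_eqF// mean_power_gain_gt0.
Qed.

Lemma power_update_descent l : simplex l -> Phi (power_update l) <= Phi l.
Proof.
move=> sl; apply: le_trans (Phi_update_le sl) _; rewrite gerDl.
by apply: power_gain_halpha_le0 => // j; exact: grad_dom.
Qed.

Lemma power_update_stationary l : simplex l -> Phi l <= Phi (power_update l) ->
  power_update l = l.
Proof.
move=> sl /le_trans/(_ (Phi_update_le sl)); rewrite lerDl => mean_halpha_ge0.
have g1 j : 0 < l j -> g l j = 1.
  by apply: power_gain_halpha_eq0 mean_halpha_ge0 _ => // i; exact: grad_dom.
rewrite power_updateE; apply/funext => j.
by have [->|/g1->] := simplex_coordP j sl; rewrite ?mul0r ?mulr1.
Qed.

Variable lam : nat -> 'I_J -> R.
Hypothesis lam0 : simplex (lam 0%N).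
Hypothesis lamS : forall n, lam n.+1 = power_update (lam n).

Lemma power_iterates_simplex n : simplex (lam n).
Proof. by elim: n => // n ih; rewrite lamS; exact: power_update_simplex. Qed.

Hypothesis lam0_gt0 : forall j, 0 < lam 0%N j.

Lemma power_iterates_gt0 n j : 0 < lam n j.
Proof.
elim: n => // n ih.
by rewrite lamS power_update_gt0//; exact: power_iterates_simplex.
Qed.

Lemma power_iterates_cvg :
  exists z, [/\ simplex z, power_update z = z & lam @ \oo --> z].
Proof.
have compactS := @compact_simplex R J.
have hausdorffW := @hausdorff_weights R J.
have update_cont := power_update_continuous.
have Phi_cont := strict_subgradient_continuous grad_continuous Phi_strict.
have lam_simplex := power_iterates_simplex.
have lam_in : (lam @ \oo) (@simplex R J).
  by exists 0%N => // n _; exact: lam_simplex.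
have [z [sz clz]] := compactS _ _ lam_in.
have cluster_fix z' : cluster (lam @ \oo) z' -> power_update z' = z'.
  apply: (cluster_lyapunov_fixpoint hausdorffW compactS update_cont lam_simplex
    lamS Phi_cont) => //.
    exact: power_update_descent.
  exact: power_update_stationary.
exists z; split => //; first exact: cluster_fix.
apply: (iterates_cvg_isolated hausdorffW compactS update_cont) => //.
  exact: cluster_fix.
apply: filterS (near_support_sub z) => z' zz' clz'; apply/esym.
apply: fixpoint_unique_on_support => //.
- exact: (cluster_iterates_in hausdorffW compactS lam_simplex).
- exact: cluster_fix.
- apply: (cluster_lyapunov_eq hausdorffW compactS lam_simplex lamS Phi_cont _
    clz clz').
  exact: power_update_descent.
Qed.

Lemma power_descent_cvg : exists z, [/\ simplex z,
  forall j, lam ^~ j @ \oo --> z j, power_update z = z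
  & forall l, simplex l -> Phi z <= Phi l].
Proof.
have [z [sz fz lamz]] := power_iterates_cvg.
exists z; split => //; first exact/cvg_coordP.
apply: gain_le_mean_minimizer => // j.
apply: (reweight_limit_le (u := lam) (v := power_gain \o lam)) => //.
- exact: power_iterates_simplex.
- exact: power_iterates_gt0.
- by move=> n i; apply: power_gain_gt0; exact: power_iterates_simplex.
- by move=> i; exact: power_gain_gt0.
- move=> i; apply: power_gain_cvg => //; apply: nearW.
  exact: power_iterates_simplex.
Qed.

End power_descent.

Section real_integrals.
Context {R : realType} {d : measure_display} {Y : measurableType d}.
Variables (nu : {measure set Y -> \bar R}) (D : set Y).
Hypothesis mD : measurable D.
Implicit Types f g : Y -> R.

Lemma integrableZl_EFin (r : R) f : nu.-integrable D (EFin \o f) ->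
  nu.-integrable D (EFin \o (fun y => r * f y)).
Proof. by move=> fi; exact: (integrableZl mD r fi). Qed.

Lemma integrableD_EFin f g : nu.-integrable D (EFin \o f) ->
  nu.-integrable D (EFin \o g) ->
  nu.-integrable D (EFin \o (fun y => f y + g y)).
Proof. by move=> fi gi; exact: (integrableD mD fi gi). Qed.

Lemma integrableB_EFin f g : nu.-integrable D (EFin \o f) ->
  nu.-integrable D (EFin \o g) ->
  nu.-integrable D (EFin \o (fun y => f y - g y)).
Proof. by move=> fi gi; exact: (integrableB mD fi gi). Qed.

Lemma integrable_lincomb (I : finType) (c : I -> R) (f : I -> Y -> R) :
  (forall i, nu.-integrable D (EFin \o f i)) ->
  nu.-integrable D (EFin \o (fun y => \sum_i c i * f i y)).
Proof.
move=> fi; rewrite (_ : _ \o _ = fun y => (\sum_i (c i * f i y)%:E)%E).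
  by apply: integrable_sum => // i _; exact: integrableZl_EFin.
by apply/funext => y; rewrite /= -sumEFin.
Qed.

Lemma Rintegral_lincomb (I : finType) (c : I -> R) (f : I -> Y -> R) :
  (forall i, nu.-integrable D (EFin \o f i)) ->
  \int[nu]_(y in D) (\sum_i c i * f i y) = \sum_i c i * \int[nu]_(y in D) f i y.
Proof.
move=> fi; apply: EFin_inj; rewrite -sumEFin fineK; last first.
  by apply: integrable_fin_num => //; exact: integrable_lincomb.
under eq_integral do rewrite -sumEFin.
rewrite integral_sum//; last by move=> i; exact: integrableZl_EFin.
apply: eq_bigr => i _; rewrite -RintegralZl// fineK//.
by apply: integrable_fin_num => //; exact: integrableZl_EFin.
Qed.

Lemma ge0_integrable f : measurable_fun D f -> (forall y, D y -> 0 <= f y) ->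
  (\int[nu]_(y in D) (f y)%:E < +oo)%E -> nu.-integrable D (EFin \o f).
Proof.
move=> mf f0 foo; apply/integrableP; split; first exact/measurable_EFinP.
rewrite (eq_integral (EFin \o f))// => y /set_mem Dy.
by rewrite gee0_abs ?lee_fin ?f0.
Qed.

Lemma le_integrabler f g : measurable_fun D f ->
  (forall y, D y -> `|f y| <= g y) -> nu.-integrable D (EFin \o g) ->
  nu.-integrable D (EFin \o f).
Proof.
move=> mf fg; apply: le_integrable => //; first exact/measurable_EFinP.
by move=> y Dy /=; rewrite lee_fin (le_trans (fg y Dy))// ler_norm.
Qed.

Lemma Rintegral_eq0_ae f : nu.-integrable D (EFin \o f) ->
  (forall y, D y -> 0 <= f y) -> \int[nu]_(y in D) f y = 0 ->
  ae_eq nu D (EFin \o f) (cst 0%E).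
Proof.
move=> fi f0 If0; have mf := measurable_int _ fi.
apply/(ae_eq_integral_abs nu mD mf).
rewrite (eq_integral (EFin \o f)); last first.
  by move=> y /set_mem Dy; rewrite gee0_abs ?lee_fin ?f0.
rewrite -[LHS]fineK; first by rewrite -[fine _]/(\int[nu]_(y in D) f y) If0.
exact: integrable_fin_num.
Qed.

End real_integrals.

Section measurable_real_functions.
Context {R : realType} {d : measure_display} {Y : measurableType d}.
Variable D : set Y.

Lemma measurable_bigmax (I : Type) (s : seq I) (m : R) (f : I -> Y -> R) :
  (forall i, measurable_fun D (f i)) ->
  measurable_fun D (fun y => \big[Num.max/m]_(i <- s) f i y).
Proof.
move=> mf; elim: s => [|i s ih].
  by under eq_fun do rewrite big_nil; exact: measurable_cst.
by under eq_fun do rewrite big_cons; exact: measurable_maxr.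
Qed.

Lemma measurable_fun_powRr (f : Y -> R) r :
  measurable_fun D f -> measurable_fun D (fun y => f y `^ r).
Proof. exact: (measurableT_comp (measurable_powR r)). Qed.

Lemma measurable_fun_ln (f : Y -> R) :
  measurable_fun D f -> measurable_fun D (fun y => ln (f y)).
Proof. exact: (measurableT_comp (@measurable_ln R)). Qed.

Lemma measurable_fun_div_ge0 (f g : Y -> R) : (forall y, 0 <= g y) ->
  measurable_fun D f -> measurable_fun D g ->
  measurable_fun D (fun y => f y / g y).
Proof.
move=> g0 mf mg; apply: measurable_funM => //.
by under eq_fun do rewrite -powR_inv1//; exact: measurable_fun_powRr.
Qed.

End measurable_real_functions.

Lemma jointly_measurable_section (R : realType) (T : topologicalType)
    (d : measure_display) (Y : measurableType d) (k : T -> Y -> R) (t : T) :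
  jointly_measurable k -> measurable_fun setT (k t).
Proof.
move=> mk _ B mB; rewrite setTI.
suff: @prod_sigma T d Y `<=` [set X | measurable [set y | X (t, y)]].
  by move=> /(_ _ (mk B mB)).
apply: smallest_sub; first split => /=.
- by rewrite (_ : [set _ | _] = set0).
- move=> X mX; rewrite (_ : [set _ | _] = ~` [set y | X (t, y)]).
    exact: measurableC.
  by apply/seteqP; split => y //= [].
- by move=> X mX; exact: (bigcupT_measurable (fun n => [set y | X n (t, y)])).
- move=> _ [A [C [_ [mC ->]]]] /=.
  have [At|At] := pselect (A t).
    by rewrite (_ : [set _ | _] = C)//; apply/seteqP; split => y //= [].
  by rewrite (_ : [set _ | _] = set0)//; apply/seteqP; split => y //= [].
Qed.

Section mixture_divergence.
Context {R : realType} {d : measure_display} {Y : measurableType d}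
  {T : Type} {J : nat}.
Variables (nu : {measure set Y -> \bar R}) (k : T -> Y -> R) (p : Y -> R)
  (a : R) (Th : 'I_J -> T).
Hypothesis a_lt1 : a < 1.
Hypothesis measurable_k : forall j, measurable_fun setT (k (Th j)).
Hypothesis integral_k : forall j, (\int[nu]_y (k (Th j) y)%:E = 1)%E.
Hypothesis measurable_p : measurable_fun setT p.
Hypothesis k_gt0 : forall j y, 0 < k (Th j) y.
Hypothesis p_gt0 : forall y, 0 < p y.
Hypothesis p_fin : (\int[nu]_y (p y)%:E < +oo)%E.
Hypothesis envelope_fin : (\int[nu]_y ((\big[Num.max/0]_(j < J) k (Th j) y)
  * (\big[Num.max/0]_(j' < J) (k (Th j') y / p y) `^ (a - 1)))%:E < +oo)%E.
Hypothesis ln_fin : a = 0 ->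
  (\int[nu]_y ((\big[Num.max/0]_(j < J) `|ln (k (Th j) y / p y)|) * p y)%:E
     < +oo)%E.

Implicit Types (l z g : 'I_J -> R) (y : Y) (j : 'I_J).

Let a_neq1 : a != 1. Proof. by rewrite lt_eqF. Qed.

Definition density_ratio y j : R := k (Th j) y / p y.

Definition mix_ratio l y : R := mixk k Th l y / p y.

Definition score l j y : R := k (Th j) y * mix_ratio l y `^ (a - 1).

Definition mix_score l j : R := \int[nu]_y score l j y.

Definition mix_divergence l : R := \int[nu]_y (falpha a (mix_ratio l y) * p y).

Definition mix_gradient l j : R := bmu nu k p a Th l (Th j).

Lemma mix_ratioE l y : mix_ratio l y = mean l (density_ratio y).
Proof.
by rewrite /mix_ratio /mixk mulr_suml; apply: eq_bigr => j _; rewrite -mulrA.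
Qed.

Lemma mix_ratioK l y : mix_ratio l y * p y = mixk k Th l y.
Proof. by rewrite /mix_ratio divfK// gt_eqF. Qed.

Lemma density_ratio_gt0 y j : 0 < density_ratio y j.
Proof. exact: divr_gt0. Qed.

Lemma mixk_gt0 l y : simplex l -> 0 < mixk k Th l y.
Proof. by move=> sl; apply: mean_gt0 => // j _; exact: k_gt0. Qed.

Lemma mix_ratio_gt0 l y : simplex l -> 0 < mix_ratio l y.
Proof. by move=> sl; rewrite divr_gt0// mixk_gt0. Qed.

Lemma measurable_density_ratio j : measurable_fun setT (density_ratio ^~ j).
Proof. by apply: measurable_fun_div_ge0 => // y; exact: ltW. Qed.

Lemma measurable_mix_ratio l : measurable_fun setT (mix_ratio l).
Proof.
apply: measurable_fun_div_ge0 => //; first by move=> y; exact: ltW.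
by apply: measurable_sum => j; exact: measurable_funM.
Qed.

Lemma integrable_density j : nu.-integrable setT (EFin \o k (Th j)).
Proof.
by apply: ge0_integrable => // [y _|]; [exact: ltW|rewrite integral_k ltry].
Qed.

Lemma Rintegral_density j : \int[nu]_y k (Th j) y = 1.
Proof. by rewrite /Rintegral integral_k. Qed.

Lemma integrable_target : nu.-integrable setT (EFin \o p).
Proof. by apply: ge0_integrable => // y _; exact: ltW. Qed.

Let envelope y := (\big[Num.max/0]_(j < J) k (Th j) y)
  * (\big[Num.max/0]_(j' < J) (k (Th j') y / p y) `^ (a - 1)).

Let integrable_envelope : nu.-integrable setT (EFin \o envelope).
Proof.
apply: ge0_integrable => // [|y _]; last by rewrite mulr_ge0// bigmax_ge_id.
apply: measurable_funM; apply: measurable_bigmax => // j.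
exact/measurable_fun_powRr/measurable_density_ratio.
Qed.

Let score_gt0 l j y : simplex l -> 0 < score l j y.
Proof. by move=> sl; rewrite mulr_gt0// powR_gt0// mix_ratio_gt0. Qed.

Let score_le_envelope l j y : simplex l -> score l j y <= envelope y.
Proof.
move=> sl; rewrite /score /envelope ler_pM ?powR_ge0//; first exact: ltW.
  exact: (le_bigmax 0 (fun j => k (Th j) y)).
rewrite mix_ratioE; apply: powR_mean_le => // [j'|].
  exact: density_ratio_gt0.
by rewrite subr_le0 ltW.
Qed.

Let norm_score_le_envelope l j y : simplex l -> `|score l j y| <= envelope y.
Proof. by move=> sl; rewrite gtr0_norm ?score_gt0// score_le_envelope. Qed.

Lemma measurable_score l j : measurable_fun setT (score l j).
Proof.
exact/measurable_funM/measurable_fun_powRr/measurable_mix_ratio.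
Qed.

Lemma integrable_score l j : simplex l ->
  nu.-integrable setT (EFin \o score l j).
Proof.
move=> sl; apply: (le_integrabler _ _ _ integrable_envelope) => //.
  exact: measurable_score.
by move=> y _; exact: norm_score_le_envelope.
Qed.

Lemma mix_score_gt0 l j : simplex l -> 0 < mix_score l j.
Proof.
move=> sl; have score_ge0 y : setT y -> 0 <= score l j y.
  by rewrite ltW ?score_gt0.
rewrite lt_def Rintegral_ge0// andbT; apply/negP => /eqP mix_score0.
have density0 : ae_eq nu setT (EFin \o k (Th j)) (cst 0%E).
  have := Rintegral_eq0_ae measurableT (integrable_score j sl) score_ge0
    mix_score0.
  by apply: filterS => y /= /(_ I) [] /eqP; rewrite gt_eqF ?score_gt0.
have := integral_k j; rewrite (ae_eq_integral (cst 0%E) _ _ _ _ density0)//;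
  last exact/measurable_EFinP.
by rewrite integral_cst// mul0e => -[] /eqP; rewrite eq_sym oner_eq0.
Qed.

Lemma b_integrandE l j y : b_integrand k p a Th l (Th j) y =
  (a - 1)^-1 * (score l j y - k (Th j) y).
Proof. by rewrite /b_integrand /dfalpha /score -/(mix_ratio l y); ring. Qed.

Lemma integrable_b_integrand l j : simplex l ->
  nu.-integrable setT (EFin \o b_integrand k p a Th l (Th j)).
Proof.
move=> sl; rewrite (funext (b_integrandE l j)).
apply: integrableZl_EFin => //.
exact: integrableB_EFin (integrable_score j sl) (integrable_density j).
Qed.

Lemma mix_scoreE l j : simplex l ->
  (a - 1) * mix_gradient l j + 1 = mix_score l j.
Proof.
move=> sl; have [iS iK] := (integrable_score j sl, integrable_density j).
rewrite /mix_gradient /bmu (funext (b_integrandE l j)).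
rewrite RintegralZl//; last exact: integrableB_EFin.
by rewrite RintegralB// Rintegral_density mulVKf ?subrK// subr_eq0.
Qed.

Lemma mix_gradient_dom l j : simplex l -> 0 < (a - 1) * mix_gradient l j + 1.
Proof. by move=> sl; rewrite mix_scoreE// mix_score_gt0. Qed.

Section continuity.
Import ArrowAsProduct.

Lemma mix_score_continuous j :
  {within @simplex R J, continuous (mix_score ^~ j)}.
Proof.
apply: (@sequential_within_continuous R {ptws 'I_J -> R}) => u z su sz uz.
apply: fine_cvg; rewrite fineK; last first.
  by apply: integrable_fin_num => //; exact: integrable_score.
have [] := @dominated_convergence _ _ _ nu setT measurableT
  (fun n y => (score (u n) j y)%:E) (EFin \o score z j) (EFin \o envelope).
- by move=> n; exact/measurable_EFinP/measurable_score.
- exact/measurable_EFinP/measurable_score.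
- apply: aeW => y _; apply: cvg_EFin; first by apply: nearW => n.
  apply: cvgM; first exact: cvg_cst.
  apply: powR_cvg; first exact: mix_ratio_gt0.
  rewrite mix_ratioE; under eq_cvg do rewrite mix_ratioE.
  by apply: mean_cvg => // i; exact: cvg_cst.
- exact: integrable_envelope.
- by apply: aeW => y n _; rewrite lee_fin norm_score_le_envelope.
- by move=> _ _.
Qed.

Lemma mix_gradient_continuous j :
  {within @simplex R J, continuous (mix_gradient ^~ j)}.
Proof.
apply: (@subspace_eq_continuous _ _ _ (fun l => (mix_score l j - 1) / (a - 1))).
  move=> l /set_mem sl.
  by rewrite -mix_scoreE// addrK mulrC mulKf// subr_eq0.
move=> z; apply: cvgM; last exact: cvg_cst.
by apply: cvgB; [exact: mix_score_continuous|exact: cvg_cst].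
Qed.

End continuity.

Lemma integrable_mixk (c : 'I_J -> R) :
  nu.-integrable setT (EFin \o mixk k Th c).
Proof. by apply: integrable_lincomb => // j; exact: integrable_density. Qed.

Lemma Rintegral_mixk (c : 'I_J -> R) :
  \int[nu]_y mixk k Th c y = \sum_(j < J) c j.
Proof.
rewrite Rintegral_lincomb//; last exact: integrable_density.
by apply: eq_bigr => j _; rewrite Rintegral_density mulr1.
Qed.

Lemma mixkB l z y :
  mixk k Th (fun j => l j - z j) y = (mix_ratio l y - mix_ratio z y) * p y.
Proof. by rewrite mulrBl !mix_ratioK; exact: meanBl. Qed.

Lemma integrable_ln_mix_ratio l : a = 0 -> simplex l ->
  nu.-integrable setT (EFin \o (fun y => ln (mix_ratio l y) * p y)).
Proof.
move=> a0 sl; pose M y := \big[Num.max/0]_(j < J) `|ln (density_ratio y j)|.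
have iM : nu.-integrable setT (EFin \o (fun y => M y * p y)).
  apply: ge0_integrable => [|y _|]; last exact: ln_fin.
    apply: measurable_funM => //; apply: measurable_bigmax => j.
    apply: measurableT_comp => //.
    exact/measurable_fun_ln/measurable_density_ratio.
  by rewrite mulr_ge0 ?bigmax_ge_id// ltW.
apply: (le_integrabler _ _ _ iM) => // [|y _].
  by apply: measurable_funM => //; exact/measurable_fun_ln/measurable_mix_ratio.
rewrite normrM (gtr0_norm (p_gt0 y)) ler_wpM2r ?(ltW (p_gt0 y))//.
by rewrite mix_ratioE norm_ln_mean_le// => j; exact: density_ratio_gt0.
Qed.

Lemma falpha0_mix_ratio l y : a = 0 -> falpha a (mix_ratio l y) * p y =
  mixk k Th l y - p y - ln (mix_ratio l y) * p y.
Proof. by move=> a0; rewrite /falpha a0 eqxx -mix_ratioK; ring. Qed.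

Lemma falpha_neq0_mix_ratio l y : a != 0 -> simplex l ->
  falpha a (mix_ratio l y) * p y =
  (a * (a - 1))^-1 * mean l (score l ^~ y) - (a - 1)^-1 * mixk k Th l y
  + a^-1 * p y.
Proof.
move=> a0 sl; have scoreE : mean l (score l ^~ y) =
    mix_ratio l y `^ (a - 1) * mix_ratio l y * p y.
  rewrite -mulrA mix_ratioK mulrC [RHS]mulr_suml; apply: eq_bigr => j _.
  exact: mulrA.
rewrite scoreE powR_subr1M ?mix_ratio_gt0// -mix_ratioK.
rewrite /falpha (negbTE a0) (negbTE a_neq1); field.
by rewrite a0 subr_eq0 a_neq1.
Qed.

Lemma integrable_divergence l : simplex l ->
  nu.-integrable setT (EFin \o (fun y => falpha a (mix_ratio l y) * p y)).
Proof.
move=> sl; have [a0|a0] := eqVneq a 0.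
  rewrite (funext (fun y => falpha0_mix_ratio l y a0)).
  apply: integrableB_EFin (integrable_ln_mix_ratio a0 sl) => //.
  exact: integrableB_EFin (integrable_mixk l) integrable_target.
rewrite (funext (fun y => falpha_neq0_mix_ratio y a0 sl)).
apply: integrableD_EFin => //; last exact/integrableZl_EFin/integrable_target.
apply: integrableB_EFin => //; last exact/integrableZl_EFin/integrable_mixk.
apply: integrableZl_EFin => //; apply: integrable_lincomb => // j.
exact: integrable_score.
Qed.

Lemma PsiE l : simplex l -> Psi nu k p a Th l = (mix_divergence l)%:E.
Proof.
move=> sl; rewrite -[LHS]fineK//; apply: integrable_fin_num => //.
exact: integrable_divergence.
Qed.

Definition bregman l z y : R :=
  mix_ratio z y `^ a * falpha a (mix_ratio l y / mix_ratio z y) * p y.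

Lemma bregman_ge0 l z y : simplex l -> simplex z -> 0 <= bregman l z y.
Proof.
move=> sl sz; rewrite mulr_ge0 ?(ltW (p_gt0 y))// mulr_ge0 ?powR_ge0//.
by rewrite falpha_ge0// divr_gt0 ?mix_ratio_gt0.
Qed.

Lemma bregman_eq0 l z y : simplex l -> simplex z -> bregman l z y = 0 ->
  mixk k Th (fun j => l j - z j) y = 0.
Proof.
move=> sl sz /eqP; have [wl wz] := (mix_ratio_gt0 y sl, mix_ratio_gt0 y sz).
rewrite !mulf_eq0 (gt_eqF (p_gt0 y)) orbF gt_eqF ?powR_gt0//= => falpha0.
have /eqP/divr1_eq ratioE : mix_ratio l y / mix_ratio z y == 1.
  by apply: contraTT falpha0 => neq1; rewrite gt_eqF// falpha_gt0// divr_gt0.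
by rewrite mixkB ratioE subrr mul0r.
Qed.

Lemma bregmanE l z y : simplex l -> simplex z -> bregman l z y =
  falpha a (mix_ratio l y) * p y - falpha a (mix_ratio z y) * p y
  - \sum_(j < J) (l j - z j) * b_integrand k p a Th z (Th j) y.
Proof.
move=> sl sz.
have -> : \sum_(j < J) (l j - z j) * b_integrand k p a Th z (Th j) y =
    (mix_ratio l y - mix_ratio z y) * p y * dfalpha a (mix_ratio z y).
  by rewrite -mixkB mulr_suml; apply: eq_bigr => j _; rewrite mulrA.
have [wl wz] := (mix_ratio_gt0 y sl, mix_ratio_gt0 y sz).
by rewrite (falpha_bregman a_neq1 wz wl) /bregman; ring.
Qed.

Let integrable_b_lincomb (c : 'I_J -> R) z : simplex z ->
  nu.-integrable setT
    (EFin \o (fun y => \sum_(j < J) c j * b_integrand k p a Th z (Th j) y)).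
Proof.
by move=> sz; apply: integrable_lincomb => // j; exact: integrable_b_integrand.
Qed.

Let integrable_divergenceB l z : simplex l -> simplex z ->
  nu.-integrable setT (EFin \o
    (fun y => falpha a (mix_ratio l y) * p y - falpha a (mix_ratio z y) * p y)).
Proof.
by move=> sl sz; apply: integrableB_EFin => //; exact: integrable_divergence.
Qed.

Lemma integrable_bregman l z : simplex l -> simplex z ->
  nu.-integrable setT (EFin \o bregman l z).
Proof.
move=> sl sz; rewrite (funext (fun y => bregmanE y sl sz)).
by apply: integrableB_EFin => //;
  [exact: integrable_divergenceB|exact: integrable_b_lincomb].
Qed.

Lemma Rintegral_bregman l z : simplex l -> simplex z ->
  \int[nu]_y bregman l z y = mix_divergence l - mix_divergence z
  - (mean l (mix_gradient z) - mean z (mix_gradient z)).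
Proof.
move=> sl sz; rewrite (funext (fun y => bregmanE y sl sz)).
rewrite RintegralB//;
  [|exact: integrable_divergenceB|exact: integrable_b_lincomb].
rewrite RintegralB//; [|exact: integrable_divergence..].
rewrite Rintegral_lincomb//; first by rewrite -meanBl.
by move=> j; exact: integrable_b_integrand.
Qed.

Lemma lin_indep_mixk_ae_eq0 c : lin_indep_measures nu k Th ->
  ae_eq nu setT (EFin \o mixk k Th c) (cst 0%E) ->
  forall j, c j = 0.
Proof.
move=> indep mix0; apply: indep => A mA.
have kA j : nu.-integrable A (EFin \o k (Th j)).
  by apply: integrableS (integrable_density j).
have KmeasE j : Kmeas nu k (Th j) A = (\int[nu]_(y in A) k (Th j) y)%:E.
  by rewrite /Rintegral fineK//; exact: (integrable_fin_num mA (kA j)).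
under eq_bigr do rewrite KmeasE -EFinM.
rewrite sumEFin -Rintegral_lincomb//; congr EFin.
rewrite /Rintegral (ae_eq_integral (cst 0%E) (EFin \o mixk k Th c))//.
- by rewrite integral_cst// mul0e.
- exact/measurable_funTS/(measurable_int nu)/integrable_mixk.
- by apply: filterS mix0 => y mixy0 _; exact: mixy0.
Qed.

Lemma mix_divergence_strict_subgradient : lin_indep_measures nu k Th ->
  strict_subgradient mix_divergence mix_gradient.
Proof.
move=> indep l z sl sz lz.
have breg_ge0 y : setT y -> 0 <= bregman l z y by move=> _; exact: bregman_ge0.
suff: 0 < \int[nu]_y bregman l z y by rewrite Rintegral_bregman//; lra.
rewrite lt_def Rintegral_ge0// andbT; apply: contra lz => /eqP breg0.
apply/eqP/funext => j; apply/eqP; rewrite -subr_eq0; apply/eqP; move: j.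
apply: lin_indep_mixk_ae_eq0 indep _.
have := Rintegral_eq0_ae measurableT (integrable_bregman sl sz) breg_ge0 breg0.
apply: filterS => y /= /(_ I) [] breg0y _.
by rewrite (bregman_eq0 sl sz breg0y).
Qed.

(* The posterior weights l j * k (Th j) y / mixk k Th l y average g to the ratio
   of the two mixtures, so this is Jensen's inequality for halpha. *)
Lemma halpha_mix_ratio_scale l g y : simplex l -> (forall j, 0 < g j) ->
  mix_ratio l y `^ a *
    halpha a (mix_ratio (fun j => l j * g j) y / mix_ratio l y) * p y <=
  mean (fun j => l j * halpha a (g j)) (score l ^~ y).
Proof.
move=> sl g0; pose posterior := reweight l (fun j => k (Th j) y).
have m0 : 0 < mixk k Th l y by exact: mixk_gt0.
have w0 : 0 < mix_ratio l y by exact: mix_ratio_gt0.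
have posterior_simplex : simplex posterior by exact: reweight_simplex.
have -> : mix_ratio (fun j => l j * g j) y / mix_ratio l y = mean posterior g.
  rewrite mean_reweight -[mean l (fun j => k (Th j) y)]/(mixk k Th l y).
  have -> : mean l (fun j => k (Th j) y * g j) =
      mixk k Th (fun j => l j * g j) y.
    by apply: eq_bigr => j _; rewrite mulrCA mulrC.
  by rewrite /mix_ratio; field; rewrite !gt_eqF.
have -> : mean (fun j => l j * halpha a (g j)) (score l ^~ y) =
    mix_ratio l y `^ (a - 1) * mixk k Th l y * mean posterior (halpha a \o g).
  rewrite mean_reweight -[mean l (fun j => k (Th j) y)]/(mixk k Th l y).
  rewrite -mulrA [mixk _ _ _ _ * _]mulrC divfK ?gt_eqF// -meanZr.
  by apply: eq_bigr => j _; rewrite /score /=; ring.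
rewrite -(powR_subr1M a w0) mulrAC -(mulrA _ (mix_ratio l y)) mix_ratioK.
by rewrite ler_wpM2l ?halpha_jensen// mulr_ge0 ?powR_ge0 ?ltW.
Qed.

Lemma falpha_mix_ratio_scale l g y : simplex l ->
  simplex (fun j => l j * g j) -> (forall j, 0 < g j) ->
  falpha a (mix_ratio (fun j => l j * g j) y) * p y <=
  falpha a (mix_ratio l y) * p y
  + mean (fun j => l j * halpha a (g j)) (score l ^~ y)
  - (a - 1)^-1 * mixk k Th (fun j => l j * g j - l j) y.
Proof.
move=> sl slg g0; have := halpha_mix_ratio_scale y sl g0.
have [w0 wg0] := (mix_ratio_gt0 y sl, mix_ratio_gt0 y slg).
rewrite -{2}[mix_ratio (fun j => l j * g j) y](divfK (lt0r_neq0 w0)).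
rewrite (falphaM a_neq1 (divr_gt0 wg0 w0) w0) divfK ?gt_eqF// mixkB.
by lra.
Qed.

Lemma mix_divergence_scale l g : simplex l -> (forall j, 0 < g j) ->
  mean l g = 1 ->
  mix_divergence (fun j => l j * g j) <= mix_divergence l
  + mean l (fun j => ((a - 1) * mix_gradient l j + 1) * halpha a (g j)).
Proof.
move=> sl g0 lg1.
have slg : simplex (fun j => l j * g j).
  by split => // j; rewrite mulr_ge0 ?sl.1// ltW.
have -> : mean l (fun j => ((a - 1) * mix_gradient l j + 1) * halpha a (g j)) =
    mean (fun j => l j * halpha a (g j)) (mix_score l).
  by apply: eq_bigr => j _; rewrite mix_scoreE// -mulrA [halpha a _ * _]mulrC.
have i_score : nu.-integrable setT
    (EFin \o (fun y => mean (fun j => l j * halpha a (g j)) (score l ^~ y))).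
  by apply: integrable_lincomb => // j; exact: integrable_score.
have i_shift : nu.-integrable setT
    (EFin \o (fun y => (a - 1)^-1 * mixk k Th (fun j => l j * g j - l j) y)).
  by apply: integrableZl_EFin => //; exact: integrable_mixk.
have i_sum := integrableD_EFin measurableT (integrable_divergence sl) i_score.
have := le_Rintegral measurableT (integrable_divergence slg)
  (integrableB_EFin measurableT i_sum i_shift)
  (fun y _ => falpha_mix_ratio_scale y sl slg g0).
rewrite RintegralB// RintegralD//; last exact: integrable_divergence.
rewrite RintegralZl//; last exact: integrable_mixk.
rewrite Rintegral_mixk sumrB sl.2 slg.2 subrr mulr0 subr0.
by rewrite Rintegral_lincomb// => j; exact: integrable_score.
Qed.

Section power_descent_on_mixtures.
Variables eta kappa : R.
Hypotheses (eta_gt0 : 0 < eta) (kappa_le0 : kappa <= 0).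

Lemma Gamma_alpha_dom l j : simplex l ->
  0 < (a - 1) * (bmu nu k p a Th l (Th j) + kappa) + 1.
Proof. exact: (power_gain_dom a_lt1 kappa_le0 mix_gradient_dom). Qed.

Lemma norm_sum_gt0 l : simplex l -> 0 < norm_sum nu k p a eta kappa Th l.
Proof. exact: (mean_power_gain_gt0 _ a_lt1 kappa_le0 mix_gradient_dom). Qed.

Lemma Imixt_simplex l : simplex l -> simplex (Imixt nu k p a eta kappa Th l).
Proof. exact: (power_update_simplex _ a_lt1 kappa_le0 mix_gradient_dom). Qed.

Hypothesis eta_le1 : eta <= 1.

Lemma Psi_Imixt_le l : simplex l ->
  (Psi nu k p a Th (Imixt nu k p a eta kappa Th l) <= Psi nu k p a Th l)%E.
Proof.
move=> sl; rewrite (PsiE sl) (PsiE (Imixt_simplex sl)) lee_fin.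
exact: (power_update_descent a_lt1 eta_gt0 kappa_le0 mix_gradient_dom eta_le1
  mix_divergence_scale).
Qed.

Hypothesis indep : lin_indep_measures nu k Th.

Lemma Imixt_iterates_cvg (lam : nat -> 'I_J -> R) : simplex_pos (lam 0%N) ->
  (forall n, lam n.+1 = Imixt nu k p a eta kappa Th (lam n)) ->
  exists z, [/\ simplex z, forall j, (fun n => lam n j) @ \oo --> z j,
    Imixt nu k p a eta kappa Th z = z &
    forall l, simplex l -> (Psi nu k p a Th z <= Psi nu k p a Th l)%E].
Proof.
move=> [lam0 lam1] lamS; have [] := power_descent_cvg a_lt1 eta_gt0 kappa_le0
  mix_gradient_dom mix_gradient_continuous
  (mix_divergence_strict_subgradient indep) eta_le1 mix_divergence_scale
  (conj (fun j => ltW (lam0 j)) lam1) lamS lam0.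
move=> z [sz cz fz minz]; exists z; split => // l sl.
by rewrite !PsiE// lee_fin minz.
Qed.

End power_descent_on_mixtures.

End mixture_divergence.

Lemma ereal_inf_minimum (R : realType) (T : Type) (A : set T) (f : T -> \bar R)
    (z : T) :
  A z -> (forall l, A l -> (f z <= f l)%E) ->
  f z = ereal_inf [set f l | l in A].
Proof.
move=> Az fz; apply/eqP; rewrite eq_le; apply/andP; split.
  by apply: le_ereal_inf_tmp => _ [l Al <-]; exact: fz.
by apply: ereal_inf_lbound; exists z.
Qed.

Unset Implicit Arguments.

Theorem theorem2 (R : realType) (d : measure_display) (Y : measurableType d)
  (nu : {measure set Y -> \bar R}) (T : pseudoMetricType R)
  (k : T -> Y -> R) (p : Y -> R) (a : R) (J : nat) (Th : 'I_J -> T)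
  (kappa : R) :
  (* standing assumptions *)
  sigma_finite setT nu ->
  jointly_measurable k ->
  (forall th, (\int[nu]_y (k th y)%:E = 1)%E) ->
  measurable_fun setT p ->
  (* (A1) *)
  (forall th y, 0 < k th y) ->
  (forall y, 0 < p y) ->
  (\int[nu]_y (p y)%:E < +oo)%E ->
  (* (A3)(i) *)
  (forall y, continuous (fun th => k th y)) ->
  (* (A3)(ii) *)
  (\int[nu]_y ((\big[Num.max/0]_(j < J) k (Th j) y)
       * (\big[Num.max/0]_(j' < J) (k (Th j') y / p y) `^ (a - 1)))%:E < +oo)%E ->
  (a = 0 ->
     (\int[nu]_y ((\big[Num.max/0]_(j < J) `|ln (k (Th j) y / p y)|) * p y)%:E
        < +oo)%E) ->
  a < 1 -> kappa <= 0 ->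
  (forall lam, simplex lam -> (Psi nu k p a Th lam < +oo)%E) /\
  (forall eta, 0 < eta ->
   forall lams : nat -> 'I_J -> R,
     simplex (lams 0%N) ->
     (forall n, lams n.+1 = Imixt nu k p a eta kappa Th (lams n)) ->
     (* well-definedness *)
     (forall n,
        (forall j, nu.-integrable setT
                     (fun y => (b_integrand k p a Th (lams n) (Th j) y)%:E)) /\
        (forall j, 0 < (a - 1) * (bmu nu k p a Th (lams n) (Th j) + kappa) + 1) /\
        0 < norm_sum nu k p a eta kappa Th (lams n)) /\
     (simplex_pos (lams 0%N) -> eta <= 1 -> lin_indep_measures nu k Th ->
       (* (i) *)
       (forall n, (Psi nu k p a Th (lams n.+1) <= Psi nu k p a Th (lams n))%E) /\
       (* (ii) and (iii) *)
       exists lstar : 'I_J -> R,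
         simplex lstar /\
         (forall j, (fun n => lams n j) @ \oo --> lstar j) /\
         Imixt nu k p a eta kappa Th lstar = lstar /\
         Psi nu k p a Th lstar
           = ereal_inf [set Psi nu k p a Th l | l in simplex (J := J)])).
Proof.
move=> _ jm k1 mp k_gt0 p_gt0 p_fin _ dom_fin ln_fin a_lt1 kappa_le0.
have mk j : measurable_fun setT (k (Th j)) by exact: jointly_measurable_section.
split=> [l sl|eta eta_gt0 lams s0 lamsS]; first by rewrite PsiE// ltry.
have lamsP n : simplex (lams n).
  by elim: n => // n ih; rewrite lamsS; exact: Imixt_simplex.
split=> [n|lam0 eta_le1 indep].
  split=> [j|]; first exact: integrable_b_integrand.
  by split=> [j|]; [exact: Gamma_alpha_dom|exact: norm_sum_gt0].
split=> [n|]; first by rewrite lamsS; exact: Psi_Imixt_le.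
have [z [sz cz fz minz]] := Imixt_iterates_cvg a_lt1 mk (fun j => k1 (Th j)) mp
  (fun j => k_gt0 (Th j)) p_gt0 p_fin dom_fin ln_fin eta_gt0 kappa_le0 eta_le1
  indep lam0 lamsS.
by exists z; do 3! split => //; exact: ereal_inf_minimum.
Qed.
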